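(* Let $\mathfrak{A}$ be a unital $C^*$-algebra and let $a\in\mathfrak{A}$ be non-zero. Then the following statements are equivalent: (i) $dw_{\mathfrak{A}}(a)=\sqrt{w_{\mathfrak{A}}^2(a)+\|a\|^4}$. (ii) There exists a state $f\in\mathfrak{S}(\mathfrak{A})$ such that $|f(a^2)|=\|a\|^2$. (iii) There exists a state $f\in\mathfrak{S}(\mathfrak{A})$ such that $|f(aa^*a)|=\|a\|^3$.
   Context: $\mathfrak{A}$ is a complex unital $C^*$-algebra with unit $\boldsymbol{1}$; its state space $\mathfrak{S}(\mathfrak{A})$ is the set of all positive linear functionals $f\in\mathfrak{A}^*$ with $\|f\|=f(\boldsymbol{1})=1$. For $a\in\mathfrak{A}$: the algebraic numerical radius is $w_{\mathfrak{A}}(a)=\sup\{|f(a)|:f\in\mathfrak{S}(\mathfrak{A})\}$; the algebraic Davis--Wielandt radius is $dw_{\mathfrak{A}}(a)=\sup\{\sqrt{|f(a)|^2+f(a^*a)^2}:f\in\mathfrak{S}(\mathfrak{A})\}$; $w_{\mathfrak{A}}^2(a)=(w_{\mathfrak{A}}(a))^2$. *)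

(* Defs.v *)
From HB Require Import structures.
From mathcomp Require Import all_boot all_order all_algebra.
From mathcomp Require Import all_classical all_reals all_analysis.
From mathcomp Require Import complex.

Set Implicit Arguments.
Unset Strict Implicit.
Unset Printing Implicit Defensive.

Import Order.TTheory GRing.Theory Num.Theory.
Import numFieldNormedType.Exports.

Local Open Scope classical_set_scope.
Local Open Scope complex_scope.
Local Open Scope ring_scope.

(* Modulus of a complex number, as an element of [R] (the generic [`|z|] lives
   in [R[i]]). *)
Notation cmod := ComplexField.Normc.normc.

(* The hierarchy has no join of rings with normed modules, and none can be added
   after [numDomainType]; hence the norm is a field of the mixin. It is
   real-valued, so that suprema can be taken in [R].
   [algType] is unital with [1 != 0], so the zero algebra is excluded. *)
HB.mixin Record isCStarAlgebra (R : realType) (A : Type)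
    of GRing.Algebra R[i] A := {
  cnorm : A -> R ;
  cnormD : forall x y : A, cnorm (x + y) <= cnorm x + cnorm y ;
  cnormZ : forall (c : R[i]) (x : A), cnorm (c *: x) = cmod c * cnorm x ;
  cnorm0_eq0 : forall x : A, cnorm x = 0 -> x = 0 ;
  cnormM : forall x y : A, cnorm (x * y) <= cnorm x * cnorm y ;
  cnorm_complete : forall u : nat -> A,
    (forall e : R, 0 < e -> exists N : nat, forall m n : nat,
       (N <= m)%N -> (N <= n)%N -> cnorm (u m - u n) < e) ->
    exists l : A, (fun n => cnorm (u n - l)) @ \oo --> (0 : R) ;
  star : A -> A ;
  starD : forall x y : A, star (x + y) = star x + star y ;
  starZ : forall (c : R[i]) (x : A), star (c *: x) = c^* *: star x ;
  starM : forall x y : A, star (x * y) = star y * star x ;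
  starK : involutive star ;
  cstar_identity : forall x : A, cnorm (star x * x) = cnorm x ^+ 2
}.

#[short(type="cstarAlgType")]
HB.structure Definition CStarAlgebra (R : realType) :=
  { A of isCStarAlgebra R A & GRing.Algebra R[i] A }.

Definition bounded_functional (R : realType) (A : cstarAlgType R)
    (f : {scalar A}) : Prop :=
  exists M : R, forall x : A, cmod (f x) <= M * cnorm x.

Definition dual_norm (R : realType) (A : cstarAlgType R) (f : {scalar A}) : R :=
  sup [set cmod (f x) | x in [set x : A | cnorm x <= 1]].

(* [0 <= z] in [R[i]] means that [z] is real and nonnegative. *)
Definition positive_functional (R : realType) (A : cstarAlgType R)
    (f : {scalar A}) : Prop :=
  forall x : A, 0 <= f (star x * x).

(* Boundedness is stated separately because [sup] has a junk value on unbounded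
   sets. *)
Definition state_space (R : realType) (A : cstarAlgType R) : set {scalar A} :=
  [set f | [/\ bounded_functional f, positive_functional f,
               dual_norm f = 1 & f 1 = 1]].
Arguments state_space {R} A _.

Definition alg_numerical_radius (R : realType) (A : cstarAlgType R) (a : A) :
    R :=
  sup [set cmod (f a) | f in state_space A].

(* [f (star a * a)] is a nonnegative real for every state [f], so taking its
   real part only changes its type. *)
Definition alg_davis_wielandt_radius (R : realType) (A : cstarAlgType R)
    (a : A) : R :=
  sup [set Num.sqrt (cmod (f a) ^+ 2 + complex.Re (f (star a * a)) ^+ 2)
      | f in state_space A].

(* Main.v *)
Require Import Defs.
From HB Require Import structures.
From mathcomp Require Import all_boot all_order all_algebra.
From mathcomp Require Import all_classical all_reals all_analysis.
From mathcomp Require Import complex ring lra.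
Set Implicit Arguments.
Unset Strict Implicit.
Unset Printing Implicit Defensive.
Import Order.TTheory GRing.Theory Num.Theory.
Import numFieldNormedType.Exports.
Local Open Scope ring_scope.

(* Each condition is equivalent to the existence of a state whose GNS vector is
   an eigenvector of [a] with eigenvalue of modulus [|a|]. If a state attains
   the norm of [b], then its vector is an eigenvector of [b], by Cauchy-Schwarz;
   so (ii) makes it an eigenvector of [a^2], (iii) one of both [a^* a] and
   [a a^* a], and an eigenvector of [a] itself follows by factoring. For (i), an
   ultrafilter limit of nearly optimal states attains both [w(a)] and [|a|^2];
   its vector then satisfies a quadratic equation in [a] whose two roots have
   modulus [|a|]. *)

(** * Modulus of complex numbers *)

Lemma normC_cmod (R : realType) (z : R[i]) : `|z| = (cmod z)%:C%C.
Proof. by []. Qed.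

Lemma cmod_ge0 (R : realType) (z : R[i]) : 0 <= cmod z.
Proof. by rewrite -lecR -normC_cmod normr_ge0. Qed.

Lemma cmod_conj (R : realType) (z : R[i]) : cmod z^* = cmod z.
Proof. by apply: complexI; rewrite -!normC_cmod norm_conjC. Qed.

Lemma cmod_of_mul_conj (R : realType) (z : R[i]) (m : R) :
  0 <= m -> z * z^* = (m ^+ 2)%:C%C -> cmod z = m.
Proof.
move=> m0; rewrite -normCK normC_cmod -rmorphXn => /complexI /eqP.
by rewrite eqrXn2 ?cmod_ge0// => /eqP.
Qed.

Lemma Re_le_cmod (R : realType) (z : R[i]) : `|complex.Re z| <= cmod z.
Proof.
case: z => p q /=; rewrite -sqrtr_sqr ler_sqrt; last by rewrite addr_ge0 ?sqr_ge0.
by rewrite lerDl sqr_ge0.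
Qed.

Lemma Im_le_cmod (R : realType) (z : R[i]) : `|complex.Im z| <= cmod z.
Proof.
case: z => p q /=; rewrite -sqrtr_sqr ler_sqrt; last by rewrite addr_ge0 ?sqr_ge0.
by rewrite lerDr sqr_ge0.
Qed.

Lemma cmod_sqr (R : realType) (z : R[i]) :
  cmod z ^+ 2 = complex.Re z ^+ 2 + complex.Im z ^+ 2.
Proof. by case: z => p q /=; rewrite sqr_sqrtr// addr_ge0 ?sqr_ge0. Qed.

(** * Norm and involution of a C*-algebra *)

Section Cstar_norm.
Context {R : realType} {A : cstarAlgType R}.
Implicit Types x y : A.

Lemma starB x y : star (x - y) = star x - star y.
Proof. by rewrite starD -scaleN1r starZ rmorphN1 scaleN1r. Qed.

Lemma star1 : star 1 = 1 :> A.
Proof. by have := starM (star 1) (1 : A); rewrite mulr1 starK mulr1. Qed.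

Lemma cnorm0 : cnorm (0 : A) = 0.
Proof. by rewrite -(scale0r (0 : A)) cnormZ ComplexField.Normc.normc0 mul0r. Qed.

Lemma cnormN x : cnorm (- x) = cnorm x.
Proof. by rewrite -scaleN1r cnormZ normcN ComplexField.Normc.normc1 mul1r. Qed.

Lemma cnorm_ge0 x : 0 <= cnorm x.
Proof.
have := cnormD x (- x); rewrite subrr cnorm0 cnormN -mulr2n.
by rewrite pmulrn_lge0.
Qed.

Lemma cnorm_gt0 x : (0 < cnorm x) = (x != 0).
Proof.
rewrite lt0r cnorm_ge0 andbT; congr (~~ _).
by apply/eqP/eqP => [/cnorm0_eq0|->]; rewrite ?cnorm0.
Qed.

(** The estimate [|y| ^ 2 = |star y * y| <= |star y| |y|] gives one inequality; applied to [star x]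
    it gives the other. *)
Lemma cnorm_star x : cnorm (star x) = cnorm x.
Proof.
suff h y : cnorm y <= cnorm (star y) by apply/le_anti; rewrite h -{2}(starK x) h.
have [->|y0] := eqVneq y 0; first by rewrite cnorm0 cnorm_ge0.
rewrite -(ler_pM2r (_ : 0 < cnorm y)) ?cnorm_gt0//.
by rewrite -expr2 -cstar_identity cnormM.
Qed.

Lemma cnorm1 : cnorm (1 : A) = 1.
Proof.
have h : 0 < cnorm (1 : A) by rewrite cnorm_gt0 oner_neq0.
apply: (mulfI (lt0r_neq0 h)).
by rewrite mulr1 -expr2 -cstar_identity star1 mulr1.
Qed.

Lemma cnormX x k : cnorm (x ^+ k) <= cnorm x ^+ k.
Proof.
elim: k => [|k ih]; first by rewrite !expr0 cnorm1.
by rewrite !exprS (le_trans (cnormM _ _))// ler_wpM2l// cnorm_ge0.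
Qed.

End Cstar_norm.

(** * Positive functionals and the Cauchy-Schwarz inequality *)

Section Positive_functional.
Context {R : realType} {A : cstarAlgType R}.
Implicit Types (f : {scalar A}) (h x y z : A).

Lemma scalarZ f (c : R[i]) x : f (c *: x) = c * f x.
Proof. exact: linearZ. Qed.

(** Polarization: with [B] and [D] the two mixed terms, reality of the form at [x + y] makes [B + D]
    real, and at [x + i y] it makes [i (B - D)] real; hence [D = B^*]. The weight [h] covers
    elements known to be positive only in the GNS representation of [f]. *)
Lemma positive_form_hermitian f h x y :
  (forall z, 0 <= f (star z * h * z)) ->
  f (star y * h * x) = (f (star x * h * y))^*.
Proof.
move=> pos.
have re z : (f (star z * h * z))^* = f (star z * h * z).
  exact: (geC0_conj (pos z)).
have expand (c : R[i]) : f (star (x + c *: y) * h * (x + c *: y)) =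
    f (star x * h * x) + c * f (star x * h * y)
    + c^* * f (star y * h * x) + c^* * (c * f (star y * h * y)).
  rewrite -!scalarZ -!linearD; congr (f _).
  by rewrite starD starZ !mulrDl !mulrDr -!scalerAl -!scalerAr !addrA.
have e1 := re (x + 1 *: y); have ei := re (x + 'i *: y).
rewrite !expand !rmorph1 !mul1r !rmorphD /= !re in e1.
rewrite !expand !(rmorphD, rmorphM) /= !conjCK conjCi !re in ei.
set B := f (star x * h * y) in e1 ei *; set D := f (star y * h * x) in e1 ei *.
set X := f (star x * h * x) in e1 ei; set Y := f (star y * h * y) in e1 ei.
have i2 : 'i * 'i = -1 :> R[i] by rewrite -expr2 sqrCi.
have {}e1 : B^* + D^* = B + D.
  have -> : B^* + D^* = (X + B^* + D^* + Y) - X - Y by ring.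
  by rewrite e1; ring.
have {}ei : 'i * (D^* - B^*) = 'i * (B - D).
  have -> : 'i * (D^* - B^*) =
      (X + - 'i * B^* + 'i * D^* + 'i * (- 'i * Y)) - X - 'i * (- 'i * Y).
    by ring.
  by rewrite ei; ring.
move/(mulfI (neq0Ci R[i])) : ei => ei.
have {}ei : 2 * D^* = 2 * B.
  rewrite [LHS](_ : _ = (B^* + D^*) + (D^* - B^*)); last by ring.
  by rewrite e1 ei; ring.
by rewrite -[LHS]conjCK (mulfI _ ei)// pnatr_eq0.
Qed.

Lemma positive_form_CauchySchwarz f h x y :
  (forall z, 0 <= f (star z * h * z)) ->
  `|f (star x * h * y)| ^+ 2 <= f (star x * h * x) * f (star y * h * y).
Proof.
move=> pos; have herm := positive_form_hermitian x y pos.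
have expand (c d : R[i]) : 0 <= c * c^* * f (star x * h * x)
    + c^* * d * f (star x * h * y)
    + d^* * c * (f (star x * h * y))^* + d * d^* * f (star y * h * y).
  rewrite -herm; apply: le_trans (pos (c *: x + d *: y)) _.
  rewrite le_eqVlt -!scalarZ -!linearD; apply/orP; left; apply/eqP; congr (f _).
  rewrite starD !starZ !mulrDl !mulrDr -!scalerAl -!scalerAr !scalerA !addrA.
  by rewrite ![_^* * _]mulrC.
move: expand (pos x) (pos y) => {herm}.
set X := f (star x * h * x); set Y := f (star y * h * y).
set B := f (star x * h * y) => expand X0.
rewrite le_eqVlt => /predU1P[Y0|Y0].
  rewrite -Y0 mulr0; have [->|Bn0] := eqVneq B 0; first by rewrite normr0 expr0n.
  have B0 : 0 < B * B^* by rewrite -normCK exprn_gt0// normr_gt0.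
  (* Put [t = (X + 1) / (2 |B| ^ 2)]. As [Y = 0], the choice [c = 1], [d = - t B^*] gives the form
     the value [X - 2 t |B| ^ 2 = -1], contradicting positivity. *)
  have /CrealP tR : (X + 1) / (2 * (B * B^*)) \is Num.real.
    by rewrite realM ?realV// ger0_real// ?addr_ge0// mulr_ge0// ltW.
  have := expand 1 (- ((X + 1) / (2 * (B * B^*))) * B^*).
  rewrite -Y0 mulr0 addr0 rmorph1 !mul1r mulr1 rmorphM rmorphN /= tR conjCK.
  rewrite [leRHS](_ : _ = -1); first by rewrite oppr_ge0 ler10.
  by field; rewrite conjC_eq0 Bn0.
(* At [c = Y], [d = - B^*] the form factors as [Y (X Y - |B| ^ 2)], and [Y > 0] can be cancelled. *)
have := expand Y (- B^*); rewrite rmorphN /= conjCK (geC0_conj (ltW Y0)).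
rewrite [leRHS](_ : _ = Y * (X * Y - B * B^*)); last by ring.
by rewrite pmulr_rge0// subr_ge0 normCK.
Qed.

Lemma positive_CauchySchwarz f x y : positive_functional f ->
  `|f (star x * y)| ^+ 2 <= f (star x * x) * f (star y * y).
Proof.
move=> pos; have := @positive_form_CauchySchwarz f 1 x y.
by rewrite !mulr1; apply => z; rewrite mulr1.
Qed.

Lemma positive_CauchySchwarz_cmod f x y : positive_functional f ->
  cmod (f (star x * y)) ^+ 2 <= cmod (f (star x * x)) * cmod (f (star y * y)).
Proof.
move=> pos; rewrite -lecR rmorphXn rmorphM /= -!normC_cmod.
rewrite [`|f (star x * x)|]ger0_norm// [`|f (star y * y)|]ger0_norm//.
exact: positive_CauchySchwarz.
Qed.

Lemma positive_star f x : positive_functional f -> f (star x) = (f x)^*.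
Proof.
move=> pos; have := @positive_form_hermitian f 1 1 x.
by rewrite !mulr1 star1 mul1r; apply => z; rewrite mulr1.
Qed.

End Positive_functional.

(** If [0 < v < u], Bernoulli's inequality makes [(u / v) ^ (2 ^ k)] exceed any [M]. Exponents
    [2 ^ k] are the ones produced by iterating the C*-identity. *)
Lemma le_of_exp2n_le (R : realType) (u v M : R) : 0 <= u -> 0 <= v ->
  (forall k, u ^+ (2 ^ k) <= M * v ^+ (2 ^ k)) -> u <= v.
Proof.
move=> u0 v0 h; rewrite leNgt; apply/negP => vu.
have [v00|vn0] := eqVneq v 0.
  have := h 0; rewrite v00 !expr1 mulr0 => /(lt_le_trans vu).
  by rewrite ltNge v0.
have {v0}v0 : 0 < v by rewrite lt0r vn0.
pose e := u / v - 1.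
have e0 : 0 < e by rewrite subr_gt0 ltr_pdivlMr ?mul1r.
have bern k : 1 + k%:R * e <= (1 + e) ^+ k.
  elim: k => [|k ih]; first by rewrite mul0r addr0 expr0.
  rewrite exprS; apply: (@le_trans _ _ ((1 + e) * (1 + k%:R * e))).
    rewrite -subr_ge0 -natr1 (_ : _ - _ = k%:R * (e * e)); last by ring.
    by rewrite !mulr_ge0// ltW.
  by rewrite ler_pM2l// addr_gt0.
have bound k : 1 + (2 ^ k)%:R * e <= M.
  apply: (le_trans (bern _)).
  by rewrite /e addrC subrK expr_div_n ler_pdivrMr ?exprn_gt0.
have [k] : exists k : nat, M / e < k%:R.
  have := archi_boundP (_ : 0 <= `|M / e|) => /(_ (normr_ge0 _)) hb.
  by exists (Num.bound `|M / e|); apply: le_lt_trans hb; exact: ler_norm.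
rewrite ltr_pdivrMr// => Mk.
have := bound k; rewrite leNgt => /negP; apply.
apply: (lt_le_trans Mk); rewrite ler_wpDl// ler_pM2r// ler_nat ltnW//.
exact: ltn_expl.
Qed.

(** * States, their norm bound and vector states *)

Section States.
Context {R : realType} {A : cstarAlgType R}.
Implicit Types (f : {scalar A}) (x y z a b : A).

(* Iterating [|f b| ^ 2 <= f (b^* b)] gives [|f b| ^ 2^k <= M |b| ^ 2^k] for all
   [k], so the bound [M] improves to [1] without any functional calculus. *)
Lemma positive_unital_le f b :
  bounded_functional f -> positive_functional f -> f 1 = 1 ->
  cmod (f b) <= cnorm b.
Proof.
move=> [M bnd] pos f1.
suff h k c : cmod (f c) ^+ (2 ^ k) <= M * cnorm c ^+ (2 ^ k).
  apply: (@le_of_exp2n_le _ _ _ M) => //; last exact: cnorm_ge0.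
  exact: cmod_ge0.
elim: k c => [c|k ih c]; first exact: bnd.
rewrite expnS !exprM -cstar_identity; apply: le_trans (ih _).
have sq : cmod (f c) ^+ 2 <= cmod (f (star c * c)).
  have := positive_CauchySchwarz_cmod 1 c pos.
  by rewrite star1 !mul1r f1 ComplexField.Normc.normc1 mul1r.
by rewrite lerXn2r// nnegrE ?exprn_ge0// cmod_ge0.
Qed.

(** By [positive_unital_le] the dual norm is at most [1], and the unit attains it. Constructing a
    state thus reduces to three checks. *)
Lemma state_spaceE f : state_space A f <->
  [/\ bounded_functional f, positive_functional f & f 1 = 1].
Proof.
split => [[]//|[bnd pos f1]]; split => //.
rewrite /dual_norm; apply/le_anti/andP; split.
  apply: ge_sup; first by exists (cmod (f 1)), 1; rewrite //= cnorm1.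
  by move=> _ [x /= x1 <-]; apply: le_trans x1; exact: positive_unital_le.
apply: sup_ubound; last by exists 1; rewrite /= ?cnorm1// f1 ComplexField.Normc.normc1.
by exists 1 => _ [x /= x1 <-]; apply: le_trans x1; exact: positive_unital_le.
Qed.

Lemma state_pos f : state_space A f -> positive_functional f.
Proof. by case. Qed.

Lemma state1 f : state_space A f -> f 1 = 1.
Proof. by case. Qed.

Lemma state_le f b : state_space A f -> cmod (f b) <= cnorm b.
Proof. by move=> /state_spaceE[]; exact: positive_unital_le. Qed.

Lemma state_normr_le f b m : state_space A f -> cnorm b <= m ->
  `|f b| <= m%:C%C.
Proof.
by move=> sf bm; rewrite normC_cmod lecR; apply: le_trans bm; exact: state_le.
Qed.

Lemma scalar_of_fun (g : A -> R[i]) :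
  (forall x y, g (x + y) = g x + g y) -> (forall c x, g (c *: x) = c * g x) ->
  exists f, f =1 g.
Proof.
move=> gD gZ.
have gl : scalar g by move=> c x y; rewrite gD gZ.
pose l := GRing.isLinear.Build R[i] A R[i] *%R g gl.
pose f : {scalar A} := HB.pack g l.
by exists f.
Qed.

(** In GNS terms [g] is the state of the normalised vector [y xi]. Positivity holds because [star y
    * (star x * x) * y = star (x * y) * (x * y)]. *)
Lemma vector_state f y : state_space A f -> f (star y * y) != 0 ->
  exists g, state_space A g /\
    forall b, g b = f (star y * b * y) / f (star y * y).
Proof.
move=> sf y0.
have pos := state_pos sf.
have [|c x|g gE] := @scalar_of_fun (fun b => f (star y * b * y) / f (star y * y)).
- by move=> x z; rewrite mulrDr mulrDl linearD mulrDl.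
- by rewrite -scalerAr -scalerAl scalarZ mulrA.
exists g; split => //; apply/state_spaceE; split.
- exists ((cnorm (star y) * cnorm y) / cmod (f (star y * y))) => b.
  rewrite gE ComplexField.Normc.normcM ComplexField.Normc.normcV.
  rewrite mulrAC ler_wpM2r//.
    by rewrite invr_ge0 cmod_ge0.
  apply: (le_trans (state_le _ sf)); apply: (le_trans (cnormM _ _)).
  rewrite mulrAC ler_wpM2r ?cnorm_ge0//; exact: cnormM.
- move=> x; rewrite gE divr_ge0 ?pos//.
  by have := pos (x * y); rewrite starM !mulrA.
- by rewrite gE mulr1 divff.
Qed.

End States.

(** * States whose GNS vector is an eigenvector *)

Section Eigenstates.
Context {R : realType} {A : cstarAlgType R}.
Implicit Types (f g : {scalar A}) (x y z a b h : A).

(* In the GNS representation of [f], with cyclic vector [xi], the second clause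
   says [a xi = d xi]. *)
Definition eigenstate f a (d : R[i]) : Prop :=
  state_space A f /\ forall x, f (x * a) = d * f x.

(** Cauchy-Schwarz for the form weighted by [h], at [star x] and [1]: [|f (x * h)| ^ 2] is at most
    [f (x * h * star x)] times [f h = 0]. *)
Lemma null_positive_form f h x :
  (forall z, 0 <= f (star z * h * z)) -> f h = 0 -> f (x * h) = 0.
Proof.
move=> pos h0; have := positive_form_CauchySchwarz (star x) 1 pos.
rewrite starK star1 mul1r !mulr1 h0 mulr0 => le0; apply/eqP.
by rewrite -normr_eq0 -sqrf_eq0 eq_le le0 exprn_ge0.
Qed.

(** This is the equality case of Cauchy-Schwarz: with [c = f b], the squared length of [(b - c) xi]
    is [f (star b * b) - |c| ^ 2 <= m ^ 2 - m ^ 2 = 0]. *)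
Lemma maximal_state_eigen f b (m : R) : state_space A f ->
  cnorm b <= m -> cmod (f b) = m -> eigenstate f b (f b).
Proof.
move=> sf bm fm; split => // x; set c := f b; have pos := state_pos sf.
have fv : f (star (b - c *: 1) * (b - c *: 1)) <= 0.
  rewrite starB starZ star1 mulrBl !mulrBr -!scalerAl -!scalerAr !mulr1 mul1r.
  rewrite !raddfB /= !scalarZ (positive_star _ pos) (state1 sf) -/c.
  have le : f (star b * b) <= c * c^*.
    rewrite -[leLHS]ger0_norm// -normCK [`|c|]normC_cmod (fm : cmod c = m) -rmorphXn /=.
    apply: state_normr_le => //; rewrite cstar_identity.
    by rewrite lerXn2r// nnegrE ?cnorm_ge0// -fm cmod_ge0.
  rewrite mulr1 [leLHS](_ : _ = f (star b * b) - c * c^*); last by ring.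
  by rewrite subr_le0.
have {}fv : f (star (b - c *: 1) * (b - c *: 1)) = 0.
  by apply/le_anti; rewrite fv pos.
have := positive_CauchySchwarz (star x) (b - c *: 1) pos.
rewrite fv mulr0 starK mulrBr raddfB /= -scalerAr mulr1 scalarZ => le0.
apply/eqP; rewrite -subr_eq0 -normr_eq0 -sqrf_eq0 eq_le le0 exprn_ge0//.
Qed.

(** The hypotheses make [y xi] a nonzero eigenvector of [a]; its vector state has it, normalised, as
    cyclic vector. *)
Lemma eigenvector_eigenstate f a y (d : R[i]) : state_space A f ->
  (forall x, f (x * a * y) = d * f (x * y)) -> f (star y * y) != 0 ->
  exists g, eigenstate g a d.
Proof.
move=> sf ay /(vector_state sf)[g [sg gE]]; exists g; split => // x.
by rewrite !gE mulrA ay mulrA.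
Qed.

(* The hypothesis says [(a - d1) (a - d2) xi = 0]: either [(a - d2) xi] is an
   eigenvector for [d1], or it vanishes. *)
Lemma quadratic_eigenstate f a (d1 d2 : R[i]) : state_space A f ->
  (forall x, f (x * a * a) = (d1 + d2) * f (x * a) - d1 * d2 * f x) ->
  exists g, eigenstate g a d1 \/ eigenstate g a d2.
Proof.
move=> sf aa; pose y := a - d2 *: 1.
have fy x : f (x * y) = f (x * a) - d2 * f x.
  by rewrite mulrBr raddfB /= -scalerAr mulr1 scalarZ.
have [y0|y0] := eqVneq (f (star y * y)) 0; last first.
  have [|g ge] := @eigenvector_eigenstate f a y d1 sf _ y0; last by exists g; left.
  by move=> x; rewrite !fy aa; ring.
exists f; right; split => // x; apply/eqP; rewrite -subr_eq0 -fy -normr_eq0.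
have := positive_CauchySchwarz (star x) y (state_pos sf).
by rewrite starK y0 mulr0 => le0; rewrite -sqrf_eq0 eq_le le0 exprn_ge0.
Qed.

Lemma eigenstateE f a d : eigenstate f a d -> f a = d.
Proof. by move=> [sf e]; rewrite -[a]mul1r e (state1 sf) mulr1. Qed.

Lemma eigenstate_star_mul f a d : eigenstate f a d -> f (star a * a) = d * d^*.
Proof.
by move=> e; rewrite e.2 (positive_star _ (state_pos e.1)) (eigenstateE e).
Qed.

End Eigenstates.

(** * From norm-attaining states to eigenstates *)

Section Norm_attaining_eigenstates.
Context {R : realType} {A : cstarAlgType R}.
Implicit Types (f g : {scalar A}) (x y z a : A).

(* The vector states show [h := 2 w - u^* a - u a^*] to be positive in the GNS
   representation of [f]; as [f h = 0], it kills the cyclic vector. *)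
Lemma numerical_radius_eigen f a (w : R) (u : R[i]) x :
  (forall g, state_space A g -> cmod (g a) <= w) ->
  state_space A f -> u * u^* = 1 -> f a = u * w%:C%C ->
  u^* * f (x * a) + u * f (x * star a) = 2 * w%:C%C * f x.
Proof.
move=> wmax sf uu fa.
have wC : (w%:C%C)^* = w%:C%C :> R[i].
  by apply: geC0_conj; rewrite ler0c; apply: le_trans (wmax f sf); exact: cmod_ge0.
pose h := (2 * w%:C%C) *: 1 - u^* *: a - u *: star a.
have fh g z : g (z * h) = 2 * w%:C%C * g z - u^* * g (z * a) - u * g (z * star a).
  by rewrite !mulrBr !raddfB /= -!scalerAr !scalarZ mulr1.
have hpos z : 0 <= f (star z * h * z).
  (* A null vector [z xi] cannot be normalised, but then Cauchy-Schwarz makes the value [0]. *)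
  have [z0|z0] := eqVneq (f (star z * z)) 0.
    have := positive_CauchySchwarz (star (star z * h)) z (state_pos sf).
    rewrite starK z0 mulr0 => le0; suff -> : f (star z * h * z) = 0 by [].
    by apply/eqP; rewrite -normr_eq0 -sqrf_eq0 eq_le le0 exprn_ge0.
  have [g [sg gE]] := vector_state sf z0.
  have -> : f (star z * h * z) = g h * f (star z * z) by rewrite gE divfK.
  (* Here [g h = 2 w - 2 Re (u^* g a)], which is nonnegative because [|u| = 1] and [|g a| <= w]. *)
  rewrite mulr_ge0 ?(state_pos sf)// -[h]mul1r fh !mul1r (state1 sg) mulr1.
  rewrite (positive_star _ (state_pos sg)).
  have -> : u * (g a)^* = (u^* * g a)^* by rewrite rmorphM /= conjCK.
  rewrite -addrA -opprD subr_ge0.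
  have -> : u^* * g a + (u^* * g a)^* = 2 * 'Re (u^* * g a).
    by rewrite ReE mulrCA divff ?mulr1 ?pnatr_eq0.
  rewrite ler_pM2l ?ltr0n//; apply: (le_trans (real_ler_norm (Creal_Re _))).
  apply: (le_trans (leif_normC_Re_Creal _)).
  have u1 : `|u| = 1 by apply/eqP; rewrite -sqrp_eq1 ?normr_ge0// normCK uu.
  by rewrite normrM norm_conjC u1 mul1r normC_cmod lecR wmax.
have h0 : f h = 0.
  rewrite -[h]mul1r fh !mul1r (state1 sf) (positive_star _ (state_pos sf)) fa.
  rewrite rmorphM /= wC [_ - _](_ : _ = 2 * w%:C%C * (1 - u * u^*)); last by ring.
  by rewrite uu subrr mulr0.
have := null_positive_form x hpos h0; rewrite fh => e; apply/eqP.
by rewrite eq_sym -subr_eq0 opprD addrA e.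
Qed.

(** The state attains the norm bound for [a ^ 2], so [a ^ 2 xi = c xi]. With [d ^ 2 = c] this reads
    [(a - d) (a + d) xi = 0], and both roots have modulus [|a|]. *)
Lemma eigenstate_of_square f a : state_space A f ->
  cmod (f (a ^+ 2)) = cnorm a ^+ 2 ->
  exists g d, eigenstate g a d /\ cmod d = cnorm a.
Proof.
move=> sf fa; have [_ e] := maximal_state_eigen sf (cnormX a 2) fa.
set c := f _ in fa e; pose d := sqrtc c.
have dd : d * d = c by rewrite -expr2 sqr_sqrtc.
have dn : cmod d = cnorm a.
  apply/eqP; rewrite -(eqrXn2 (_ : 0 < 2)%N) ?cmod_ge0 ?cnorm_ge0//; apply/eqP.
  by rewrite -fa -dd expr2 -ComplexField.Normc.normcM.
have [|g] := @quadratic_eigenstate _ _ f a d (- d) sf.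
  by move=> x; rewrite -mulrA -expr2 e -dd; ring.
by case=> ge; exists g; [exists d|exists (- d); rewrite normcN].
Qed.

(** Let [n = |a|]. Cauchy-Schwarz for [a * star a] and [a] gives [n ^ 6 <= n ^ 4 |f (star a * a)|],
    so [f] attains the norm of [star a * a] too. With [c] and [e] the eigenvalues of [star a * a]
    and [a * star a * a] at [xi], [c a xi = e xi]; so [a] has eigenvalue [e / c], of modulus
    [n ^ 3 / n ^ 2]. *)
Lemma eigenstate_of_cube f a : state_space A f -> a != 0 ->
  cmod (f (a * star a * a)) = cnorm a ^+ 3 ->
  exists g d, eigenstate g a d /\ cmod d = cnorm a.
Proof.
move=> sf a0 fa; have pos := state_pos sf.
have n0 : 0 < cnorm a by rewrite cnorm_gt0.
have aa : cmod (f (star a * a)) = cnorm a ^+ 2.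
  have h : (cnorm a ^+ 3) ^+ 2
      <= cmod (f (a * star a * (a * star a))) * cmod (f (star a * a)).
    by have := positive_CauchySchwarz_cmod (a * star a) a pos; rewrite starM starK fa.
  apply/le_anti; rewrite -{1}cstar_identity state_le//=.
  have le4 : cmod (f (a * star a * (a * star a))) <= cnorm a ^+ 4.
    apply: (le_trans (state_le _ sf)).
    have := cstar_identity (star (a * star a)); rewrite starK starM starK => ->.
    by rewrite -{1}(starK a) cstar_identity cnorm_star -exprM.
  have := le_trans h (ler_wpM2r (cmod_ge0 _) le4).
  by rewrite -exprM (_ : (3 * 2 = 4 + 2)%N)// exprD (ler_pM2l (exprn_gt0 4 n0)).
have [|_ e2] := maximal_state_eigen sf _ aa; first by rewrite cstar_identity.
have [|_ e3] := maximal_state_eigen sf _ fa.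
  rewrite !exprS expr0 mulr1 mulrA; apply: (le_trans (cnormM _ _)).
  by rewrite ler_wpM2r ?cnorm_ge0//; apply: (le_trans (cnormM _ _)); rewrite cnorm_star.
set c := f (star a * a) in e2 aa; set e := f _ in fa e3.
have c0 : c != 0.
  apply/eqP => c0; move: aa; rewrite c0 ComplexField.Normc.normc0 => /eqP.
  by rewrite eq_sym expf_eq0 gt_eqF.
exists f, (e / c); split.
  split=> // x; apply: (mulfI c0).
  have -> : c * (e / c * f x) = e * f x by field.
  by rewrite -e2 -e3 !mulrA.
rewrite ComplexField.Normc.normcM ComplexField.Normc.normcV fa aa.
by field; exact: lt0r_neq0.
Qed.

(* Here [u^* a xi + u a^* xi = 2 w xi] and [a a^* xi = n^2 xi], whence
   [a^2 xi = 2 w u a xi - u^2 n^2 xi]; as [w <= n], the roots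
   [u (w +- i sqrt (n^2 - w^2))] have modulus [n]. *)
Lemma eigenstate_of_numerical_radius f a : state_space A f ->
  (forall g, state_space A g -> cmod (g a) <= cmod (f a)) ->
  cmod (f (star a * a)) = cnorm a ^+ 2 ->
  exists g d, eigenstate g a d /\ cmod d = cnorm a.
Proof.
move=> sf wmax faa; have pos := state_pos sf.
set w := cmod (f a); set n := cnorm a.
have [u uu fa] : exists2 u : R[i], u * u^* = 1 & f a = u * w%:C%C.
  (* The scalar [u] is the phase of [f a]; if [f a = 0], any unimodular number serves. *)
  have [fa0|fa0] := eqVneq (f a) 0.
    by exists 1; rewrite /w ?fa0 ?ComplexField.Normc.normc0 ?mulr0// rmorph1 mulr1.
  exists (f a / `|f a|); last by rewrite /w -normC_cmod divfK// normr_eq0.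
  rewrite rmorphM /= fmorphV /= (geC0_conj (normr_ge0 _)) mulrACA -normCK.
  by rewrite -invfM -expr2 divff// sqrf_eq0 normr_eq0.
have key x : u^* * f (x * a) + u * f (x * star a) = 2 * w%:C%C * f x.
  exact: (numerical_radius_eigen x wmax sf uu fa).
have wC : (w%:C%C)^* = w%:C%C :> R[i] by apply: geC0_conj; rewrite ler0c cmod_ge0.
have u0 : u != 0 by apply/eqP => u0; move/eqP: uu; rewrite u0 mul0r eq_sym oner_eq0.
have [W WE] : exists W : R[i], W = w%:C%C by exists w%:C%C.
have [N NE] : exists N : R[i], N = (n ^+ 2)%:C%C by exists (n ^+ 2)%:C%C.
rewrite -WE in fa key wC.
have saE : f (star a * a) = N.
  by rewrite NE -[LHS]ger0_norm// normC_cmod faa.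
have aaE : f (a * star a) = N.
  (* Comparing [key] at [a] with the conjugate of [key] at [star a] yields
     [u f (a * star a) = u f (star a * a)]. *)
  have k1 := key a; have := congr1 Num.conj (key (star a)).
  rewrite -starM !(positive_star _ pos) rmorphD ![in LHS]rmorphM /= !conjCK.
  rewrite -(positive_star _ pos) starM starK saE.
  rewrite rmorphM /= conjCK [(2 * W)^*]rmorphM /= wC rmorph_nat => k2.
  apply: (mulfI u0).
  have -> : u * f (a * star a) = 2 * W * f a - u^* * f (a * a).
    by rewrite -k1; ring.
  by rewrite -k2; ring.
have [||_ e2] := @maximal_state_eigen _ _ f (a * star a) (n ^+ 2) sf.
- by rewrite -{1}(starK a) cstar_identity cnorm_star.
- by rewrite aaE NE /= expr0n addr0 sqrtr_sqr ger0_norm// exprn_ge0 ?cnorm_ge0.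
rewrite aaE in e2.
have wn : w <= n by exact: state_le.
pose s := Num.sqrt (n ^+ 2 - w ^+ 2).
have ss : s ^+ 2 = n ^+ 2 - w ^+ 2.
  by rewrite sqr_sqrtr// subr_ge0 lerXn2r// nnegrE ?cmod_ge0 ?cnorm_ge0.
pose d1 := u * (w +i* s)%C; pose d2 := u * (w -i* s)%C.
have [v v1 v2] : exists2 v : R[i], v + v^* = 2 * W & v * v^* = N.
  have conjE : ((w +i* s)%C : R[i])^* = (w -i* s)%C by [].
  exists (w +i* s)%C; rewrite conjE ?WE ?NE ?mulr_natl ?mulr2n; simpc.
    by [].
  by rewrite -!expr2 ss; congr (_ +i* _)%C; ring.
have [|g] := @quadratic_eigenstate _ _ f a (u * v) (u * v^* ) sf.
  move=> x; rewrite -mulrDr v1; have := key (x * a).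
  rewrite -[x * a * star a]mulrA e2 => k.
  have -> : u * (2 * W) * f (x * a) = u * (2 * W * f (x * a)) by ring.
  rewrite -k -v2 -[LHS]mul1r -uu; ring.
have vn : cmod v = n by apply: cmod_of_mul_conj; rewrite ?cnorm_ge0// v2 NE.
have u1 : cmod u = 1 by apply: cmod_of_mul_conj; rewrite ?uu ?expr1n.
by case=> ge; exists g; [exists (u * v)|exists (u * v^* )]; split=> //;
  rewrite ComplexField.Normc.normcM u1 mul1r ?cmod_conj.
Qed.

End Norm_attaining_eigenstates.

(** * Ultrafilter limits and compactness of the state space *)

Lemma ultra_cvg_bounded (R : realType) (T : Type) (U : set_system T)
  (u : T -> R) (M : R) : UltraFilter U -> (forall t, `|u t| <= M) ->
  exists l : R, (u @ U --> l)%classic.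
Proof.
move=> UU uM; have PU : ProperFilter U by exact: ultra_proper.
have [|p [_ cp]] := @segment_compact R (- M) M (u @ U)%classic.
  by apply: (@filterE _ U) => t /=; rewrite in_itv /= -ler_norml.
exists p => V pV /=.
(* If the ultrafilter chose the complement of the neighbourhood [V], the cluster point [p] would
   force that complement to meet [V]. *)
have [//|nV] := in_ultra_setVsetC (u @^-1` V)%classic UU.
by have [x [nVx Vx]] := cp (~` V)%classic V nV pV.
Qed.

Lemma cvg_le_bound (R : realType) (T : Type) (U : set_system T) (u : T -> R)
  (l M : R) : ProperFilter U -> (u @ U --> l)%classic ->
  (forall t, u t <= M) -> l <= M.
Proof.
move=> PU cu uM; rewrite -(cvg_lim (@Rhausdorff R) cu).
by apply: limr_le; [apply: cvgP cu | exact: filterE].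
Qed.

Section State_compactness.
Context {R : realType} {A : cstarAlgType R}.
Implicit Types (f g : {scalar A}) (x y a : A).
Local Open Scope classical_set_scope.

(** Weak-* compactness of the state space: real and imaginary parts are bounded by the norm, so they
    converge along [U], and the limits assemble into a state. The squared modulus is a polynomial in
    them, hence converges as well. *)
Lemma ultralimit_state (T : Type) (U : set_system T) (F : T -> {scalar A}) :
  UltraFilter U -> (forall t, state_space A (F t)) ->
  exists f, state_space A f /\ forall x,
    (fun t => complex.Re (F t x)) @ U --> complex.Re (f x) /\
    (fun t => cmod (F t x) ^+ 2) @ U --> cmod (f x) ^+ 2.
Proof.
move=> UU sF; have PU : ProperFilter U by exact: ultra_proper.
have ex x : exists l : R[i], (fun t => complex.Re (F t x)) @ U --> complex.Re l /\
    (fun t => complex.Im (F t x)) @ U --> complex.Im l.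
  have [|p cp] := @ultra_cvg_bounded _ _ U (fun t => complex.Re (F t x)) (cnorm x) UU.
    by move=> t; apply: le_trans (Re_le_cmod _) _; exact: state_le.
  have [|q cq] := @ultra_cvg_bounded _ _ U (fun t => complex.Im (F t x)) (cnorm x) UU.
    by move=> t; apply: le_trans (Im_le_cmod _) _; exact: state_le.
  by exists (p +i* q)%C.
have [g gP] := choice ex.
have geq x (l : R[i]) : (fun t => complex.Re (F t x)) @ U --> complex.Re l ->
    (fun t => complex.Im (F t x)) @ U --> complex.Im l -> g x = l.
  move=> cR cI; apply/eqP; rewrite eq_complex; apply/andP; split; apply/eqP.
    exact: (cvg_unique (@Rhausdorff R) (gP x).1 cR).
  exact: (cvg_unique (@Rhausdorff R) (gP x).2 cI).
have [x y|c x|f fg] := @scalar_of_fun R A g.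
- apply: geq; rewrite raddfD /=.
    under eq_fun do rewrite linearD raddfD.
    exact: cvgD (gP x).1 (gP y).1.
  under eq_fun do rewrite linearD raddfD.
  exact: cvgD (gP x).2 (gP y).2.
- have [gx1 gx2] := gP x; case: (g x) gx1 gx2 => p q /= gx1 gx2.
  case: c => r s; apply: geq => /=.
    rewrite (_ : (fun t => _) =
          (fun t => r * complex.Re (F t x) - s * complex.Im (F t x))).
      by apply: cvgB; apply: cvgMr.
    by apply/funext => t; rewrite scalarZ; case: (F t x).
  rewrite (_ : (fun t => _) =
        (fun t => r * complex.Im (F t x) + s * complex.Re (F t x))).
    by apply: cvgD; apply: cvgMr.
  by apply/funext => t; rewrite scalarZ; case: (F t x).
have csq x : (fun t => cmod (F t x) ^+ 2) @ U --> cmod (f x) ^+ 2.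
  rewrite fg cmod_sqr; have [cR cI] := gP x.
  under eq_fun do rewrite cmod_sqr !expr2.
  by rewrite !expr2; apply: cvgD; apply: cvgM.
exists f; split; last by move=> x; split => //; rewrite fg; exact: (gP x).1.
apply/state_spaceE; split.
(* The bound [|F t x| <= |x|] passes to the limit on squares. *)
- exists 1 => x; rewrite mul1r -(@ler_pXn2r _ 2) ?nnegrE ?cmod_ge0 ?cnorm_ge0//.
  apply: (cvg_le_bound PU (csq x)) => t.
  by rewrite lerXn2r ?nnegrE ?cmod_ge0 ?cnorm_ge0// state_le.
- move=> x; rewrite fg lecE; have [cR cI] := gP (star x * x).
  have pos t : 0 <= F t (star x * x) by apply: state_pos (sF t) x.
  apply/andP; split.
    apply/eqP; apply: (cvg_unique (@Rhausdorff R) cI).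
    rewrite (_ : (fun t => _) = fun=> 0); last first.
      by apply/funext => t; exact: ger0_Im.
    exact: cvg_cst.
  rewrite -oppr_le0; apply: (cvg_le_bound PU (cvgN cR)) => t /=.
  by rewrite oppr_le0; have := pos t; rewrite lecE => /andP[].
- rewrite fg; apply: geq => /=.
    under eq_fun do rewrite state1//.
    exact: cvg_cst.
  under eq_fun do rewrite state1//.
  exact: cvg_cst.
Qed.

End State_compactness.

(** * The Davis-Wielandt radius and the equivalence *)

Lemma eigenstate_of_dw (R : realType) (A : cstarAlgType R) (a : A) :
  a != 0 ->
  alg_davis_wielandt_radius a
    = Num.sqrt (alg_numerical_radius a ^+ 2 + cnorm a ^+ 4) ->
  exists g d, eigenstate g a d /\ cmod d = cnorm a.
Proof.
move=> a0.
set E := [set Num.sqrt (cmod (f a) ^+ 2 + complex.Re (f (star a * a)) ^+ 2)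
      | f in state_space A]%classic.
rewrite /alg_davis_wielandt_radius -/E => dwE.
set w := alg_numerical_radius a in dwE; set n := cnorm a in dwE.
have n0 : 0 < n by rewrite cnorm_gt0.
have dw0 : 0 < sup E.
  by rewrite dwE sqrtr_gt0 ltr_wpDl ?sqr_ge0// exprn_gt0.
have wle f : state_space A f -> cmod (f a) <= w.
  move=> sf; apply: sup_ubound; last by exists f.
  by exists n => _ [g sg <-]; exact: state_le.
have Rle f : state_space A f -> complex.Re (f (star a * a)) <= n ^+ 2.
  move=> sf; apply: (le_trans (ler_norm _)); apply: (le_trans (Re_le_cmod _)).
  by rewrite -cstar_identity; exact: state_le.
have Rge f : state_space A f -> 0 <= complex.Re (f (star a * a)).
  by move=> sf; have := state_pos sf a; rewrite lecE => /andP[].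
(* [sup] is [0] on the empty set, so (i) itself provides a state. *)
have E0 : (E !=set0)%classic.
  have [//|/set0P/negP/negPn/eqP E0] := pselect (E !=set0)%classic.
  by move: dw0; rewrite E0 sup0 ltxx.
have hsE : has_sup E.
  split => //; exists (Num.sqrt (w ^+ 2 + n ^+ 4)) => _ [f sf <-].
  rewrite ler_sqrt ?addr_ge0 ?exprn_ge0 ?cnorm_ge0//; last first.
    by apply: le_trans (wle f sf); exact: cmod_ge0.
  rewrite lerD//.
    by rewrite lerXn2r ?nnegrE ?cmod_ge0 ?wle// (le_trans (cmod_ge0 (f a)))// wle.
  by rewrite (_ : 4 = 2 * 2)%N// exprM lerXn2r ?nnegrE ?Rge ?Rle// exprn_ge0// ltW.
have near k : exists f, state_space A f /\ sup E - k.+1%:R^-1 <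
    Num.sqrt (cmod (f a) ^+ 2 + complex.Re (f (star a * a)) ^+ 2).
  have [|_ [f sf <-] h] := @sup_adherent _ E k.+1%:R^-1 _ hsE.
    by rewrite invr_gt0 ltr0n.
  by exists f.
have [F FP] := choice near.
(* The algebra may be non-separable, so [F] may have no subsequence converging at every element; an
   ultrafilter refining [\oo] replaces it. *)
have [U [UU sub]] := @ultraFilterLemma nat \oo%classic _.
have PU : ProperFilter U by exact: ultra_proper.
have [f [sf fP]] := ultralimit_state UU (fun k => (FP k).1).
pose v k := Num.sqrt (cmod (F k a) ^+ 2 + complex.Re (F k (star a * a)) ^+ 2).
have vle k : v k <= sup E.
  by apply: sup_ubound; [exact: hsE.2|exists (F k) => //; exact: (FP k).1].
have cv : (v @ U --> sup E)%classic.
  suff cv : (v @ \oo --> sup E)%classic by move=> V /cv; exact: sub.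
  apply: (@squeeze_cvgr _ _ _ _ (fun k => sup E - harmonic k) (cst (sup E))).
  - by apply: nearW => k; rewrite (ltW (FP k).2) vle.
  - rewrite -[X in (_ --> X)%classic]subr0; apply: cvgB.
      exact: cvg_cst.
    exact: cvg_harmonic.
  - exact: cvg_cst.
(* The limit of [v ^ 2] along [U] is computed twice: from [sup E] and from the values of [f]. *)
have fE : cmod (f a) ^+ 2 + complex.Re (f (star a * a)) ^+ 2 = w ^+ 2 + n ^+ 4.
  have -> : w ^+ 2 + n ^+ 4 = sup E ^+ 2.
    by rewrite dwE sqr_sqrtr// addr_ge0 ?sqr_ge0// exprn_ge0// ltW.
  have c1 : ((fun k => v k ^+ 2) @ U --> sup E ^+ 2)%classic.
    by rewrite expr2; under eq_fun do rewrite expr2; apply: cvgM.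
  have c2 : ((fun k => v k ^+ 2) @ U
      --> cmod (f a) ^+ 2 + complex.Re (f (star a * a)) ^+ 2)%classic.
    rewrite (_ : (fun k => _) = fun k => cmod (F k a) ^+ 2
        + complex.Re (F k (star a * a)) * complex.Re (F k (star a * a))).
      by rewrite [X in _ + X]expr2; apply: cvgD;
        [exact: (fP a).2|apply: cvgM; exact: (fP _).1].
    by apply/funext => k; rewrite /v sqr_sqrtr ?addr_ge0 ?sqr_ge0// -expr2.
  exact: (cvg_unique (@Rhausdorff R) c2 c1).
(* In [fE] each summand on the left is at most its counterpart on the right, so both are equal to
   it. *)
have wf : cmod (f a) ^+ 2 <= w ^+ 2.
  by rewrite lerXn2r ?nnegrE ?cmod_ge0 ?wle// (le_trans (cmod_ge0 (f a)))// wle.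
have Rf : complex.Re (f (star a * a)) ^+ 2 <= n ^+ 4.
  by rewrite (_ : 4 = 2 * 2)%N// exprM lerXn2r ?nnegrE ?Rge ?Rle// exprn_ge0// ltW.
have fw : cmod (f a) = w.
  apply/eqP; rewrite eq_le wle//= -(@ler_pXn2r _ 2) ?nnegrE ?cmod_ge0//; last first.
    by rewrite (le_trans (cmod_ge0 (f a)))// wle.
  by move: fE wf Rf; lra.
apply: (eigenstate_of_numerical_radius sf); first by move=> g sg; rewrite fw wle.
apply/le_anti; rewrite -[X in _ <= X]cstar_identity state_le//=.
apply: le_trans (le_trans (ler_norm _) (Re_le_cmod _)).
rewrite -(@ler_pXn2r _ 2) ?nnegrE ?Rge ?exprn_ge0 ?cnorm_ge0// -exprM.
by move: fE wf Rf; rewrite -/n; lra.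
Qed.

(** Since [|d| = |a|], the state attains the norm of [star a * a], so [xi] is an eigenvector of
    [star a * a] as well, with eigenvalue [|a| ^ 2]. *)
Lemma eigenstate_powers (R : realType) (A : cstarAlgType R) f (a : A) d :
  eigenstate f a d -> cmod d = cnorm a ->
  [/\ f (star a * a) = (cnorm a ^+ 2)%:C%C,
      f (a ^+ 2) = d ^+ 2 & f (a * star a * a) = d * (cnorm a ^+ 2)%:C%C].
Proof.
move=> e dn; have fa : f (star a * a) = (cnorm a ^+ 2)%:C%C.
  by rewrite (eigenstate_star_mul e) -normCK normC_cmod dn rmorphXn.
split => //; first by rewrite expr2 e.2 (eigenstateE e).
have [||_ e2] := @maximal_state_eigen _ _ f (star a * a) (cnorm a ^+ 2) e.1.
- by rewrite cstar_identity.
- by rewrite fa /= expr0n addr0 sqrtr_sqr ger0_norm// exprn_ge0 ?cnorm_ge0.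
by rewrite -mulrA e2 (eigenstateE e) fa mulrC.
Qed.

(** The one state [f] attains both bounds [|g a| <= n] and [g (star a * a) <= n ^ 2], valid for all
    states [g]. Hence [w = n], and both sides equal the square root of [n ^ 2 + n ^ 4]. *)
Lemma dw_of_eigenstate (R : realType) (A : cstarAlgType R) f (a : A) d :
  eigenstate f a d -> cmod d = cnorm a ->
  alg_davis_wielandt_radius a
    = Num.sqrt (alg_numerical_radius a ^+ 2 + cnorm a ^+ 4).
Proof.
move=> e dn; have [fa _ _] := eigenstate_powers e dn; set n := cnorm a in fa dn *.
have n0 : 0 <= n := cnorm_ge0 a.
have wn : alg_numerical_radius a = n.
  apply/le_anti/andP; split.
    apply: ge_sup; first by exists (cmod (f a)), f => //; exact: e.1.
    by move=> _ [g sg <-]; exact: state_le.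
  apply: sup_ubound; first by exists n => _ [g sg <-]; exact: state_le.
  by exists f; [exact: e.1|rewrite (eigenstateE e)].
have fv : Num.sqrt (cmod (f a) ^+ 2 + complex.Re (f (star a * a)) ^+ 2)
    = Num.sqrt (n ^+ 2 + n ^+ 4).
  by rewrite (eigenstateE e) dn fa /= -exprM.
have ub g : state_space A g ->
    Num.sqrt (cmod (g a) ^+ 2 + complex.Re (g (star a * a)) ^+ 2)
      <= Num.sqrt (n ^+ 2 + n ^+ 4).
  move=> sg; rewrite ler_sqrt ?addr_ge0 ?exprn_ge0// lerD//.
    by rewrite lerXn2r ?nnegrE ?cmod_ge0 ?state_le.
  rewrite -real_normK ?num_real// (_ : 4 = 2 * 2)%N// exprM.
  rewrite lerXn2r ?nnegrE ?exprn_ge0//.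
  by apply: (le_trans (Re_le_cmod _)); rewrite -cstar_identity; exact: state_le.
rewrite wn; apply/le_anti/andP; split.
  apply: ge_sup; last by move=> _ [g sg <-]; exact: ub.
  by eexists; exists f => //; exact: e.1.
apply: sup_ubound.
  by exists (Num.sqrt (n ^+ 2 + n ^+ 4)) => _ [g sg <-]; exact: ub.
by exists f; [exact: e.1|exact: fv].
Qed.

Theorem theorem4p9 (R : realType) (A : cstarAlgType R) (a : A) (a_neq0 : a != 0) :
  [<-> alg_davis_wielandt_radius a
         = Num.sqrt (alg_numerical_radius a ^+ 2 + cnorm a ^+ 4);
       exists f : {scalar A}, state_space A f /\ cmod (f (a ^+ 2)) = cnorm a ^+ 2;
       exists f : {scalar A}, state_space A f /\ cmod (f (a * star a * a)) = cnorm a ^+ 3].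
Proof.
(* The cycle (i), (ii), (iii), (i) is proved; each implication passes through an eigenstate of [a]
   with eigenvalue of modulus [|a|]. *)
tfae.
- move=> /(eigenstate_of_dw a_neq0)[f [d [e dn]]]; exists f; split; first exact: e.1.
  have [_ -> _] := eigenstate_powers e dn.
  by rewrite !expr2 ComplexField.Normc.normcM dn.
- move=> [f [sf /(eigenstate_of_square sf)[g [d [e dn]]]]].
  exists g; split; first exact: e.1.
  have [_ _ ->] := eigenstate_powers e dn.
  rewrite ComplexField.Normc.normcM dn /= expr0n addr0 sqrtr_sqr.
  by rewrite ger0_norm ?exprn_ge0 ?cnorm_ge0// -exprS.
- move=> [f [sf /(eigenstate_of_cube sf a_neq0)[g [d [e dn]]]]].
  exact: dw_of_eigenstate e dn.
Qed.
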